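(* Let $\mathbb{F}_q$ be a finite field, let $x>0$, and let $\hat{h}(x)=\prod_{k\ge1}\prod_{p\in\mathcal{I}_k}p^{a_k(x)}$ with $a_k(x)=\left\lfloor \frac{1}{q^{k/x}-1}\right\rfloor$. (1) If $x\notin S$, then there is only one $x$-semi-superior highly composite polynomial, namely $\hat{h}(x)$. (2) If $x=\frac{s\log q}{\log(1+1/r)}\in S$ (with integers $s,r\ge1$), then the $x$-semi-superior highly composite polynomials are exactly the $2^{\pi(s)}$ polynomials of the form $$h(x)=\frac{\hat{h}(x)}{P_{i_1}\cdots P_{i_v}},$$ where $0\le v\le \pi(s)$ and $P_{i_1},\dots,P_{i_v}\in\mathcal{I}_s$ are distinct; such $h(x)$ has $\deg h(x)=\deg\hat{h}(x)-vs$. Moreover, the unique polynomials $h$ of this form given by $v=\pi(s)$ and $v=0$ are two distinct consecutive superior highly composite polynomials (consecutive when superior highly composite polynomials are ordered by degree). (3) If $h(x)$ is $x$-semi-superior highly composite and $g\in\mathcal{M}_{\deg h(x)}$ is a highly composite polynomial, then $g$ is also $x$-semi-superior highly composite.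
   Context: $\mathcal{M}$ is the set of monic polynomials in $\mathbb{F}_q[t]$, $\mathcal{M}_n$ those of degree $n$, $\mathcal{I}_k$ the set of monic irreducible polynomials of degree $k$, and $\pi(k)=|\mathcal{I}_k|$. For $f\in\mathcal{M}$, $\tau(f)$ is the number of monic divisors of $f$. $S=\left\{\frac{s\log q}{\log(1+1/r)} : s,r\ge 1 \text{ integers}\right\}$. A polynomial $f$ is highly composite if $\tau(f)=\max\{\tau(g): g\in\mathcal{M},\ \deg g\le\deg f\}$. For $x>0$, $h\in\mathcal{M}$ is $x$-superior highly composite ($x$-SHC) if for all $f\in\mathcal{M}$: $\tau(h)/q^{\deg h/x}\ge \tau(f)/q^{\deg f/x}$ when $\deg h\ge\deg f$ and $>$ when $\deg h<\deg f$; it is $x$-semi-superior highly composite ($x$-SSHC) if $\tau(h)/q^{\deg h/x}\ge \tau(f)/q^{\deg f/x}$ for all $f\in\mathcal{M}$. A polynomial is superior highly composite if it is $x$-SHC for some $x>0$. *)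

(* Defs.v *)
From mathcomp Require Import all_boot all_order all_algebra finmap qpoly.
From mathcomp Require Import all_classical all_reals all_analysis.

Set Implicit Arguments.
Unset Strict Implicit.
Unset Printing Implicit Defensive.
Import Order.TTheory GRing.Theory Num.Theory.

Local Open Scope classical_set_scope.
Local Open Scope ring_scope.

Section Polynomials.
Variable F : finFieldType.
Implicit Types f g h p d : {poly F}.

Definition deg f : nat := (size f).-1.

Definition Monic : set {poly F} := [set f | f \is monic].

Definition MonicDeg (n : nat) : set {poly F} := [set f | Monic f /\ deg f = n].

Definition Irr (k : nat) : set {poly F} :=
  [set p | MonicDeg k p /\ irreducible_poly p].

Definition ppi (k : nat) : nat := #|` fset_set (Irr k)|.

Definition tau f : nat := #|` fset_set [set d | Monic d /\ d %| f]|.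

(* fset_set is the empty set on infinite sets; the next facts show that this
   junk value is never used. *)
Lemma finite_size_le n : finite_set [set f : {poly F} | (size f <= n)%N].
Proof.
apply: (@sub_finite_set _ _ (range (fun f : {poly_n F} => f : {poly F}))).
  by move=> f fn; exists (NPoly fn).
exact/finite_image/finite_finset.
Qed.

Lemma finite_Irr k : finite_set (Irr k).
Proof.
apply: sub_finite_set (finite_size_le k.+1) => p [[_ <-] _] /=.
by rewrite /deg; case: (size p).
Qed.

Lemma finite_divisors f : Monic f -> finite_set [set d | Monic d /\ d %| f].
Proof.
move=> fm; apply: sub_finite_set (finite_size_le (size f)) => d [_ df] /=.
exact/dvdp_leq/df/monic_neq0.
Qed.

Definition highly_composite f : Prop :=
  Monic f /\ forall g, Monic g -> (deg g <= deg f)%N -> (tau g <= tau f)%N.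

End Polynomials.

Arguments Irr F k _ : clear implicits.

Section Superior.
Variables (R : realType) (F : finFieldType).
Implicit Types (f g h : {poly F}) (x : R).

Local Notation q := (#|F|%:R : R).

Definition Sset : set R :=
  [set x | exists s r : nat, [/\ (1 <= s)%N, (1 <= r)%N &
     x = s%:R * ln q / ln (1 + r%:R^-1)]].

Definition tau_ratio x f : R := (tau f)%:R / q `^ ((deg f)%:R / x).

Definition SHC_at x h : Prop :=
  Monic h /\ forall f, Monic f ->
    ((deg f <= deg h)%N -> tau_ratio x f <= tau_ratio x h) /\
    ((deg h < deg f)%N -> tau_ratio x f < tau_ratio x h).

Definition SSHC_at x h : Prop :=
  Monic h /\ forall f, Monic f -> tau_ratio x f <= tau_ratio x h.

Definition SHC h : Prop := exists2 x, 0 < x & SHC_at x h.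

Definition consecutive_SHC h1 h2 : Prop :=
  [/\ SHC h1, SHC h2, (deg h1 < deg h2)%N &
      forall g, SHC g -> (deg h1 <= deg g <= deg h2)%N -> g = h1 \/ g = h2].

(* For x > 0 and k >= 1 the argument of the floor is positive, so its floor is
   the natural number given by truncn. *)
Definition a_ x (k : nat) : nat := Num.truncn (q `^ (k%:R / x) - 1)^-1.

(* Finitely supported products; see a_finite_support. *)
Definition hhat x : {poly F} :=
  \big[*%R/1]_(k \in [set k : nat | (1 <= k)%N])
    \big[*%R/1]_(p \in Irr F k) p ^+ a_ x k.

Lemma a_finite_support x : 0 < x ->
  finite_set [set k : nat | (1 <= k)%N /\ a_ x k <> 0%N].
Proof.
move=> x0.
apply: (@sub_finite_set _ _ `I_(Num.bound (x / ln q)).+1); last exact: finite_II.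
have q1 : 1 < q by rewrite ltr1n card_finNzRing_gt1.
move=> k [k1 ak] /=; rewrite ltnS leqNgt; apply/negP => kb; apply: ak.
have lq : 0 < ln q by rewrite ln_gt0.
have q0 : 0 < q by rewrite (lt_trans _ q1).
have kx : 1 < k%:R / x * ln q.
  rewrite mulrAC ltr_pdivlMr// mul1r -ltr_pdivrMr//.
  apply: lt_trans (archi_boundP _) _; first by rewrite divr_ge0// ltW.
  by rewrite ltr_nat.
have e2 : 2 < q `^ (k%:R / x).
  rewrite /powR gt_eqF//; apply: lt_le_trans (expR_ge1Dx _).
  by rewrite -[2]/(1 + 1 : R) ltrD2l.
have e1 : 1 < q `^ (k%:R / x) - 1 by rewrite ltrBrDr.
apply/truncn0Pn; rewrite -ltNge invf_lt1 ?e1 //.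
exact: lt_trans ltr01 e1.
Qed.

(* h is hhat(x) divided by v distinct elements of Irr s. *)
Definition hhat_quotient x (s v : nat) h : Prop :=
  exists A : {fset {poly F}}, [/\ [set` A] `<=` Irr F s, #|` A| = v &
    h = hhat x %/ \prod_(p <- A) p].

End Superior.

(* Main.v *)
Require Import Defs.
From mathcomp Require Import all_boot all_order all_algebra finmap.
From mathcomp Require Import fingroup cyclic qpoly.
From mathcomp Require Import falgebra separable fieldext galois finfield.
From mathcomp Require Import all_classical all_reals all_analysis.
Import Order.TTheory GRing.Theory Num.Theory.

(** The ratio [tau f / q ^ (deg f / x)] is multiplicative: the factor of [f] at a
    monic irreducible [p] of degree [k] with exponent [e] is
    [gain x k e = (e + 1) / q ^ (k e / x)].  So [f] is semi-superior highly
    composite iff every exponent maximizes the corresponding [gain].  Now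
    [gain x k n.-1 <= gain x k n] iff [k ln q / ln (1 + 1/n) <= x]; the left-hand
    side increases with [n], hence the maximum is reached at [a_ x k], and also at
    [(a_ x k).-1] exactly when [x = k ln q / ln (1 + 1/n)] with [n = a_ x k].  Such
    a pair [(k, n)] is determined by [x], because [(1 + 1/m)^l = (1 + 1/n)^k]
    forces [k = l].  Superior highly composite polynomials are the [hhat y], which
    increase with [y] for divisibility; just below [x] in [S], the exponents of
    [hhat] drop by one at the irreducibles of degree [s] and nowhere else. *)

Set Implicit Arguments.
Unset Strict Implicit.
Unset Printing Implicit Defensive.

Local Open Scope classical_set_scope.
Local Open Scope ring_scope.

(** * Irreducible polynomials of every degree *)

(** The derivative is [-1], because its other coefficient [m] vanishes in [K]. *)
Lemma separable_Xn_subX (K : fieldType) (m : nat) :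
  m%:R = 0 :> K -> separable_poly ('X^m - 'X : {poly K}).
Proof.
move=> m0; rewrite unlock derivB derivXn derivX -scaler_nat m0 scale0r sub0r.
by rewrite -[X in coprimep _ X]scaleN1r coprimepZr ?oppr_eq0 ?oner_eq0 // coprimep1.
Qed.

(** [L] is the splitting field of ['X^m - 'X] with [m = #|F| ^ n]. The [m] distinct roots are the
    fixed points of the [n]-th power of Frobenius, so they form a field; as they generate [L], they
    exhaust it, and counting gives the dimension. *)
Lemma exists_finField_extension (F : finFieldType) (n : nat) : (0 < n)%N ->
  exists L : splittingFieldType F, \dim {:L} = n.
Proof.
move=> n_gt0; pose m := (#|F| ^ n)%N.
have F_gt1 := card_finNzRing_gt1 F.
have m_gt1 : (1 < m)%N by rewrite (ltn_exp2l 0).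
have size_q (K : nzRingType) : size ('X^m - 'X : {poly K}) = m.+1.
  by rewrite size_polyDl size_polyXn // size_polyN size_polyX.
have /FinSplittingFieldFor[L [zs]] : ('X^m - 'X : {poly F}) != 0.
  by rewrite -size_poly_gt0 size_q.
rewrite rmorphB rmorphXn /= map_polyX => Dzs genL; exists L.
have m0 : m%:R = 0 :> L.
  (* Lagrange in the additive group of [F]: the order of [1] divides [#|F|]. *)
  have : #|F|%:R = 0 :> F by apply/eqP; rewrite -order_dvdn -cardsT order_dvdG ?inE.
  move=> /(congr1 (in_alg L)); rewrite rmorph_nat rmorph0 /m natrX => ->.
  by rewrite expr0n gtn_eqF.
have uzs : uniq zs.
  by rewrite -separable_prod_XsubC -(eqp_separable Dzs) separable_Xn_subX.
have size_zs : size zs = m.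
  by apply: succn_inj; rewrite -(size_prod_XsubC _ id) -(eqp_size Dzs) size_q.
have [alpha _ Dalpha] := finField_galois_generator (sub1v {:L}).
(* [alpha] raises to the power [#|F|], so [alpha ^+ n] raises to the power [m]. *)
have fixed_zs z : z \in zs = (z \in fixedSpace (alpha ^+ n)%g).
  rewrite -root_prod_XsubC -(eqp_root Dzs) /root !hornerE subr_eq0.
  rewrite (sameP fixedSpaceP eqP) /m; congr (_ == z).
  elim: n {n_gt0 m m_gt1 size_q Dzs m0 size_zs} => [|i IHi].
    by rewrite gal_id.
  by rewrite expgSr galM ?memvf// Dalpha ?memvf// dimv1 expn1 -IHi expnSr exprM.
have all_zs z : z \in zs.
  rewrite fixed_zs (subvP _ z (memvf z)) // -genL.
  rewrite -[X in (_ <= X)%VS]subfield_closed agenvS // subv_add sub1v.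
  by apply/span_subvP => y; rewrite fixed_zs.
pose Lf : finFieldType := FinFieldExtType L.
have : #|Lf| = m.
  rewrite -size_zs -(@card_uniqP Lf zs uzs).
  by apply: eq_card => z; rewrite [RHS]all_zs.
have := card_vspace (fullv : {vspace finvect_type L}).
rewrite card_vspacef => cardL /(etrans (esym cardL)).
exact: expnI.
Qed.

(** The minimal polynomial of a primitive element of the extension of degree [n] has the required
    properties. *)
Lemma exists_monic_irreducible (F : finFieldType) (n : nat) : (0 < n)%N ->
  exists p : {poly F}, [/\ p \is monic, irreducible_poly p & size p = n.+1].
Proof.
move=> n_gt0; have [L dimL] := exists_finField_extension F n_gt0.
have /and3P[_ sepL _] := finField_galois (sub1v {:L}).
have := eq_adjoin_separable_generator sepL (sub1v _).
set z := separable_generator _ _ => Dz.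
have /polyOver1P[p Dp] := minPolyOver 1 z.
have sz : size p = n.+1.
  rewrite -(size_map_poly (in_alg L)) -Dp size_minPoly adjoin_degreeE.
  by rewrite -Dz dimv1 divn1 dimL.
exists p; split=> //.
  by rewrite -(map_monic (in_alg L)) -Dp monic_minPoly.
split=> [|q szq qp]; first by rewrite sz.
have := @minPoly_irr _ _ 1 z (map_poly (in_alg L) q).
rewrite Dp dvdp_map qp eqp_map -(size_poly_eq1 (map_poly _ q)).
rewrite size_map_poly (negPf szq) orbF; apply=> //.
by apply/polyOver1P; exists q.
Qed.

(** * Factorization and number of divisors *)

Section Factorization.
Variable F : finFieldType.
Implicit Types (f g p d : {poly F}) (e : {poly F} -> nat) (s : seq {poly F}).

Definition monic_irreducible p := p \is monic /\ irreducible_poly p.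

Lemma deg_irreducible_gt0 p : irreducible_poly p -> (0 < deg p)%N.
Proof. by case=> p_gt1 _; rewrite /deg -ltnS prednK // ltnW. Qed.

Lemma degM f g : f != 0 -> g != 0 -> deg (f * g) = (deg f + deg g)%N.
Proof.
move=> f0 g0; rewrite /deg size_mul//.
move: f0 g0; rewrite -!size_poly_gt0.
by case: (size f) (size g) => // m [|n]// _ _; rewrite addnS.
Qed.

Lemma monic_dvdp_deg_eq f g :
  f \is monic -> g \is monic -> f %| g -> (deg g <= deg f)%N -> f = g.
Proof.
move=> fm gm fg gf; apply/eqP; rewrite -eqp_monic// -dvdp_size_eqp//.
rewrite eqn_leq dvdp_leq ?monic_neq0//=; move: gf; rewrite /deg.
have := monic_neq0 fm; have := monic_neq0 gm; rewrite -!size_poly_gt0.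
by case: (size g) (size f) => // a [].
Qed.

Lemma coprimep_irreducible p q : monic_irreducible p -> monic_irreducible q ->
  p != q -> coprimep p q.
Proof.
move=> [pm pirr] [qm qirr]; rewrite irreducible_poly_coprime// => pq.
apply: contra pq => pq; rewrite -eqp_monic//; apply: qirr => //.
by case: pirr => + _; case: (size p) => [|[]].
Qed.

Lemma monic_prod_exp s e : {in s, forall p, monic_irreducible p} ->
  \prod_(p <- s) p ^+ e p \is monic.
Proof.
move=> sirr; rewrite big_seq; apply: monic_prod => p /sirr[pm _].
exact: monic_exp.
Qed.

Lemma coprimep_prod_exp p s e : monic_irreducible p ->
  {in s, forall q, monic_irreducible q} -> p \notin s ->
  coprimep p (\prod_(q <- s) q ^+ e q).
Proof.
move=> pirr sirr ps; rewrite big_seq; elim/big_ind : _ => [|f g pf pg|q qs].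
- exact: coprimep1.
- by rewrite coprimepMr pf.
- apply/coprimep_expr/coprimep_irreducible => //; first exact: sirr.
  by apply: contraNneq ps => ->.
Qed.

Lemma dvdp_prod_seq p s : monic_irreducible p ->
  {in s, forall q, monic_irreducible q} -> (p %| \prod_(q <- s) q) = (p \in s).
Proof.
move=> pirr sirr; have [ps|ps] := boolP (p \in s).
  by rewrite (big_rem p)//= dvdp_mulr.
apply/negbTE; rewrite -irreducible_poly_coprime; last by case: pirr.
have := coprimep_prod_exp (fun=> 1%N) pirr sirr ps.
by under eq_bigr do rewrite expr1.
Qed.

(** Divide by [p] as long as possible; the size decreases at each division. *)
Lemma irreducible_valuation p d : irreducible_poly p -> d != 0 ->
  exists i d', d = p ^+ i * d' /\ coprimep p d'.
Proof.
move=> pirr; move: {2}(size d) (leqnn (size d)) => n.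
elim: n d => [d|n IHn d dn d0].
  by rewrite leqn0 size_poly_eq0 => /eqP->; rewrite eqxx.
have [pd|/negbTE pd] := boolP (p %| d); last first.
  by exists 0%N, d; rewrite expr0 mul1r irreducible_poly_coprime// pd.
have p0 := irredp_neq0 pirr.
have q0 : d %/ p != 0 by rewrite divpN0// dvdp_leq.
have szq : (size (d %/ p)%R <= n)%N.
  rewrite size_divp// -ltnS; apply: leq_trans dn.
  have := pirr.1; rewrite -size_poly_gt0 in d0; case: (size p) => [|[|m]]// _.
  by rewrite /= ltn_subrL.
have [i [d' [Dd pd']]] := IHn _ szq q0.
by exists i.+1, d'; rewrite exprS -mulrA -Dd mulrC divpK.
Qed.

(** Induction on [e]: the divisors of [p ^+ e.+1 * g] are those of [p ^+ e * g], together with the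
    products [p ^+ e.+1 * d] for [d] dividing [g]. The two families are disjoint, and the second one
    has [tau g] members. *)
Lemma tau_irreducible_expM p g (e : nat) :
  monic_irreducible p -> Monic g -> coprimep p g ->
  tau (p ^+ e * g) = (e.+1 * tau g)%N.
Proof.
move=> [pm pirr] gm pg; have p0 := irredp_neq0 pirr.
have mon n : Monic (p ^+ n * g) by rewrite /Monic /= rpredM// rpredX.
elim: e => [|e IHe]; first by rewrite expr0 !mul1r mul1n.
rewrite mulSn -IHe addnC /tau.
set D := fset_set [set d | Monic d /\ d %| g].
set E := fset_set [set d | Monic d /\ d %| p ^+ e * g].
have -> : fset_set [set d | Monic d /\ d %| p ^+ e.+1 * g] =
    (E `|` [fset p ^+ e.+1 * d | d in D])%fset.
  apply/fsetP => d; rewrite in_fsetU /E !in_fset_set; try exact: finite_divisors.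
  apply/idP/orP; rewrite !inE; last first.
    case=> [[dm dd]|/imfsetP[d' /=]].
      by split=> //; apply: dvdp_trans dd _; rewrite dvdp_mul2r ?monic_neq0// dvdp_exp2l.
    rewrite in_fset_set; last exact: finite_divisors.
    rewrite inE => -[dm' dd'] ->; split; first by rewrite /Monic/= rpredM// rpredX.
    by rewrite dvdp_mul2l ?expf_neq0.
  move=> [dm dd].
  have [i [d' [Dd pd']]] := irreducible_valuation pirr (monic_neq0 dm).
  have d'm : d' \is monic by move: dm; rewrite /Monic/= Dd monicMl// rpredX.
  have d'g : d' %| g.
    have : d' %| p ^+ e.+1 * g by apply: dvdp_trans dd; rewrite Dd dvdp_mull.
    by rewrite Gauss_dvdpr// coprimep_sym coprimep_expl.
  have [ie|ei] := leqP i e; [left|right].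
    by split=> //; rewrite Dd dvdp_mul// dvdp_exp2l.
  have ie : i = e.+1.
    apply/eqP; rewrite eqn_leq ei andbT.
    have : p ^+ i %| p ^+ e.+1 * g by apply: dvdp_trans dd; rewrite Dd dvdp_mulr.
    by rewrite Gauss_dvdpl ?coprimep_expl// dvdp_Pexp2l//; case: pirr.
  apply/imfsetP; exists d'; last by rewrite Dd ie.
  by rewrite /D /= in_fset_set ?inE//; exact: finite_divisors.
rewrite cardfsU.
have -> : (E `&` [fset p ^+ e.+1 * d | d in D])%fset = fset0.
  apply/fsetP => d; rewrite in_fsetI in_fset0 /E in_fset_set; last exact: finite_divisors.
  apply/negP => /andP[]; rewrite inE => -[_ dd] /imfsetP[d' _ Dd].
  have : p ^+ e.+1 %| p ^+ e * g by apply: dvdp_trans dd; rewrite Dd dvdp_mulr.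
  rewrite exprSr dvdp_mul2l ?expf_neq0//; apply/negP.
  by rewrite -irreducible_poly_coprime.
rewrite cardfs0 subn0 card_imfset//=.
by apply: mulfI; rewrite expf_neq0.
Qed.

Lemma tau1 : tau (1 : {poly F}) = 1%N.
Proof.
rewrite /tau (_ : [set d | _] = [set 1]) ?fset_set1 ?cardfs1//.
apply/seteqP; split=> [d [dm]|_ ->].
  by rewrite dvdp1 size_poly_eq1 eqp_monic ?monic1// => /eqP ->.
by split=> //; exact: monic1.
Qed.

Lemma tau_prod_exp s e : uniq s -> {in s, forall p, monic_irreducible p} ->
  tau (\prod_(p <- s) p ^+ e p) = (\prod_(p <- s) (e p).+1)%N.
Proof.
elim: s => [|p s IHs] /=; first by rewrite !big_nil tau1.
move=> /andP[ps us] sirr; rewrite !big_cons.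
have sirr' : {in s, forall p, monic_irreducible p}.
  by move=> q qs; apply: sirr; rewrite inE qs orbT.
have pirr : monic_irreducible p by apply: sirr; rewrite mem_head.
rewrite tau_irreducible_expM ?IHs//; first exact: monic_prod_exp.
exact: coprimep_prod_exp.
Qed.

Lemma deg_prod_exp s e : {in s, forall p, monic_irreducible p} ->
  deg (\prod_(p <- s) p ^+ e p) = (\sum_(p <- s) e p * deg p)%N.
Proof.
elim: s => [|p s IHs] sirr; first by rewrite !big_nil /deg size_poly1.
have sirr' : {in s, forall p, monic_irreducible p}.
  by move=> q qs; apply: sirr; rewrite inE qs orbT.
have [pm _] := sirr _ (mem_head _ _).
rewrite !big_cons degM ?expf_neq0 ?monic_neq0// ?monic_prod_exp//.
by rewrite IHs// {1}/deg size_exp mulnC.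
Qed.

(** * Products over the monic irreducibles of bounded degree *)

Fixpoint irr_seq N : seq {poly F} :=
  if N is n.+1 then irr_seq n ++ fset_set (Irr F n.+1) else [::].

Lemma mem_irr_seq N p :
  p \in irr_seq N <-> monic_irreducible p /\ (deg p <= N)%N.
Proof.
elim: N => [|N IHN] /=.
  split=> // -[[_ /deg_irreducible_gt0]]; by rewrite leqn0; case: deg.
rewrite mem_cat; split=> [/orP[/IHN[? /leqW//]|]|].
  by rewrite in_fset_set ?inE; [move=> [[pm ->] pirr]|exact: finite_Irr].
move=> [pirr]; rewrite leq_eqVlt => /predU1P[pN|]; last first.
  by rewrite ltnS => pN; rewrite (IHN.2 _).
by rewrite in_fset_set ?[_ \in Irr _ _]mem_set ?orbT//; [case: pirr|exact: finite_Irr].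
Qed.

Lemma uniq_irr_seq N : uniq (irr_seq N).
Proof.
elim: N => //= N IHN; rewrite cat_uniq IHN fset_uniq andbT/=.
apply/hasPn => p; rewrite in_fset_set ?inE; last exact: finite_Irr.
by move=> [[_ pN] _]; apply/negP => /mem_irr_seq[_]; rewrite pN ltnn.
Qed.

Lemma irr_seq_irr N : {in irr_seq N, forall p, monic_irreducible p}.
Proof. by move=> p /mem_irr_seq[]. Qed.

(** Bounding the degree by [N] keeps the product finite, so that polynomials are handled through
    their exponent functions [e]. *)
Definition pprod N e := \prod_(p <- irr_seq N) p ^+ e p.

Lemma exists_irreducible_factor f : (0 < deg f)%N ->
  exists2 p, monic_irreducible p & p %| f.
Proof.
move=> f_gt0; have [n nf] := ubnP (size f); elim: n f f_gt0 nf => // n IHn f f_gt0 fn.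
have f0 : f != 0 by apply: contraTneq f_gt0 => ->; rewrite /deg size_poly0.
have f1 : (1 < size f)%N by move: f_gt0; rewrite /deg; case: (size f).
have [[d [d1 df dNf]]|nd] := pselect (exists d, [/\ size d != 1%N, d %| f & ~~ (d %= f)]).
  have d0 : d != 0 by apply: dvdpN0 df f0.
  have [||p pirr pd] := IHn d.
  - rewrite /deg; move: d0 d1; rewrite -size_poly_gt0; by case: (size d) => [|[]].
  - apply: leq_trans (fn : (size f <= n)%N); rewrite ltn_neqAle dvdp_leq// andbT.
    by rewrite dvdp_size_eqp.
  by exists p => //; apply: dvdp_trans df.
(* Without a proper nonconstant divisor, [f] is irreducible itself and only has to be made monic. *)
exists ((lead_coef f)^-1 *: f); last by rewrite dvdpZl ?invr_neq0 ?lead_coef_eq0.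
split; first by rewrite monicE lead_coefZ mulVf ?lead_coef_eq0.
split; first by rewrite size_scale ?invr_neq0 ?lead_coef_eq0.
move=> d d1; rewrite dvdpZr ?invr_neq0 ?lead_coef_eq0// => df.
have : d %= f by apply: contrapT => /negP dNf; apply: nd; exists d.
move=> /eqp_trans; apply; rewrite eqp_sym.
by apply: eqp_scale; rewrite invr_neq0 ?lead_coef_eq0.
Qed.

Lemma pprodD N e e' : pprod N (fun p => e p + e' p)%N = pprod N e * pprod N e'.
Proof. by rewrite /pprod -big_split/=; apply: eq_bigr => p _; rewrite exprD. Qed.

(** With [pprodD], this turns multiplication by distinct irreducibles into adding an indicator
    function to the exponents. *)
Lemma prod_indicator N s : uniq s -> {subset s <= irr_seq N} ->
  pprod N (fun p => p \in s) = \prod_(p <- s) p.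
Proof.
move=> us sN; rewrite /pprod.
transitivity (\prod_(p <- irr_seq N | p \in s) p).
  rewrite [RHS]big_mkcond/=; apply: eq_bigr => p _.
  by case: ifP; rewrite ?expr1 ?expr0.
rewrite -big_filter; apply: perm_big; apply: uniq_perm => //.
  by rewrite filter_uniq// uniq_irr_seq.
move=> p; rewrite mem_filter; have [ps|//] := boolP (p \in s).
by rewrite (sN _ ps).
Qed.

Lemma monic_pprod N e : pprod N e \is monic.
Proof. exact/monic_prod_exp/irr_seq_irr. Qed.

Lemma eq_pprod N e e' : {in irr_seq N, e =1 e'} -> pprod N e = pprod N e'.
Proof. by move=> ee'; apply: eq_big_seq => p /ee' ->. Qed.

Lemma dvdp_pprod N e e' : {in irr_seq N, forall p, e p <= e' p}%N ->
  pprod N e %| pprod N e'.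
Proof.
move=> ee'; rewrite /pprod big_seq [X in _ %| X]big_seq.
by elim/big_ind2 : _ => // [f g f' g'|p /ee']; [exact: dvdp_mul|exact: dvdp_exp2l].
Qed.

(** Strong induction on the degree, splitting off one irreducible factor; all factors of [f] have
    degree at most [deg f]. *)
Lemma pprod_exists N f : Monic f -> (deg f <= N)%N -> exists e, f = pprod N e.
Proof.
have [n nf] := ubnP (deg f); elim: n f nf => // n IHn f fn fm fN.
have [f_gt0|] := ltnP 0 (deg f); last first.
  rewrite leqn0 => /eqP f0; exists (fun=> 0%N).
  have f1 : f = 1.
    have := monic_neq0 fm; rewrite -size_poly_gt0 => szf.
    apply/eqP; rewrite -eqp_monic ?monic1// -size_poly_eq1.
    by move: f0 szf; rewrite /deg; case: (size f) => [|[]].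
  by rewrite f1 /pprod big1.
have [p [pm pirr] pf] := exists_irreducible_factor f_gt0.
have f0 := monic_neq0 fm; have p0 := monic_neq0 pm.
have Df : f = p * (f %/ p) by rewrite mulrC divpK.
have qm : f %/ p \is monic by move: fm; rewrite /Monic/= {1}Df monicMl.
have degf : deg f = (deg p + deg (f %/ p)%R)%N by rewrite {1}Df degM// monic_neq0.
have p_gt0 := deg_irreducible_gt0 pirr.
have [||e De] := IHn (f %/ p) _ qm.
- apply: leq_trans (fn : (deg f <= n)%N); rewrite degf -[X in (X < _)%N]add0n.
  by rewrite ltn_add2r.
- by apply: leq_trans fN; rewrite degf leq_addl.
exists (fun q => (q \in [:: p]) + e q)%N.
rewrite pprodD prod_indicator ?big_seq1 -?De// => q; rewrite inE => /eqP ->.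
apply/mem_irr_seq; split=> //; apply: leq_trans fN; by rewrite degf leq_addr.
Qed.

Lemma pprod_widen N M e : (N <= M)%N ->
  (forall p, monic_irreducible p -> (N < deg p <= M)%N -> e p = 0%N) ->
  pprod M e = pprod N e.
Proof.
elim: M => [|M IHM]; first by rewrite leqn0 => /eqP->.
rewrite leq_eqVlt => /predU1P[->//|]; rewrite ltnS => NM e0.
rewrite -IHM// => [|p pirr /andP[Np pM]]; last by rewrite e0// Np leqW.
rewrite /pprod/= big_cat/= [X in _ * X]big_seq [X in _ * X]big1 ?mulr1//.
move=> p; rewrite in_fset_set ?inE; last exact: finite_Irr.
by move=> [[pm pM] pirr]; rewrite e0// pM ltnS NM leqnn.
Qed.

End Factorization.

(** * Optimal exponents *)

Section LocalFactor.
Variables (R : realType) (F : finFieldType).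
Implicit Types (x y : R) (k n e : nat).
Local Notation q := (#|F|%:R : R).

(** The values at positive [k] and [n] are exactly the elements of [Sset]. *)
Definition threshold k n : R := k%:R * ln q / ln (1 + n%:R^-1).

Definition cost x k : R := q `^ (k%:R / x).

Definition gain x k e : R := e.+1%:R / cost x k ^+ e.

Lemma q_gt1 : 1 < q.
Proof. by rewrite ltr1n card_finNzRing_gt1. Qed.

Lemma ln_q_gt0 : 0 < ln q.
Proof. by rewrite ln_gt0// q_gt1. Qed.

Lemma ln1DV_gt0 n : (0 < n)%N -> 0 < ln (1 + n%:R^-1 : R).
Proof. by move=> n0; rewrite ln_gt0// ltrDl invr_gt0 ltr0n. Qed.

Lemma threshold_gt0 k n : (0 < k)%N -> (0 < n)%N -> 0 < threshold k n.
Proof.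
by move=> k0 n0; rewrite divr_gt0 ?mulr_gt0 ?ltr0n ?ln1DV_gt0 ?ln_q_gt0.
Qed.

Lemma cost_gt0 x k : 0 < cost x k.
Proof. by rewrite powR_gt0// (lt_trans _ q_gt1). Qed.

Lemma cost_gt1 x k : 0 < x -> (0 < k)%N -> 1 < cost x k.
Proof.
move=> x0 k0; rewrite /cost /powR gt_eqF ?(lt_trans _ q_gt1)//.
by rewrite expR_gt1 mulr_gt0 ?ln_q_gt0// divr_gt0// ltr0n.
Qed.

Lemma ln_cost x k : ln (cost x k) = k%:R / x * ln q.
Proof. by rewrite /cost ln_powR. Qed.

(** Both sides say [cost x k < 1 + 1/n], the left one after taking logarithms. *)
Lemma lt_threshold x k n : 0 < x -> (0 < n)%N ->
  (threshold k n < x) = (n%:R * cost x k < n.+1%:R).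
Proof.
move=> x0 n0; have n0' : 0 < n%:R :> R by rewrite ltr0n.
rewrite [n%:R * _]mulrC -[RHS]ltr_pdivlMr// -natr1 mulrDl divff ?gt_eqF// div1r.
rewrite -[RHS]ltr_ln ?posrE ?cost_gt0 ?addr_gt0 ?invr_gt0// ln_cost.
by rewrite mulrAC [RHS]ltr_pdivrMr// [ln _ * x]mulrC -[RHS]ltr_pdivrMr ?ln1DV_gt0.
Qed.

Lemma le_threshold x k n : 0 < x -> (0 < n)%N ->
  (threshold k n <= x) = (n%:R * cost x k <= n.+1%:R).
Proof.
move=> x0 n0; have n0' : 0 < n%:R :> R by rewrite ltr0n.
rewrite [n%:R * _]mulrC -[RHS]ler_pdivlMr// -natr1 mulrDl divff ?gt_eqF// div1r.
rewrite -[RHS]ler_ln ?posrE ?cost_gt0 ?addr_gt0 ?invr_gt0// ln_cost.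
by rewrite mulrAC [RHS]ler_pdivrMr// [ln _ * x]mulrC -[RHS]ler_pdivrMr ?ln1DV_gt0.
Qed.

Lemma threshold_mono k m n : (0 < k)%N -> (0 < m)%N -> (m < n)%N ->
  threshold k m < threshold k n.
Proof.
move=> k0 m0 mn; have n0 : (0 < n)%N by apply: leq_trans mn.
rewrite /threshold ltr_pM2l ?mulr_gt0 ?ltr0n ?ln_q_gt0//.
rewrite ltf_pV2 ?posrE ?ln1DV_gt0// ltr_ln ?posrE ?addr_gt0 ?invr_gt0 ?ltr0n//.
by rewrite ltrD2l ltf_pV2 ?posrE ?ltr0n// ltr_nat.
Qed.

(** With [c = cost x k > 1], [n <= 1 / (c - 1)] amounts to [n * c <= n + 1]. Hence [a_ x k] counts
    the thresholds of degree [k] up to [x]. *)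
Lemma leq_a x k n : 0 < x -> (0 < k)%N -> (0 < n)%N ->
  (n <= a_ F x k)%N = (threshold k n <= x).
Proof.
move=> x0 k0 n0.
have c_gt1 : 0 < cost x k - 1 by rewrite subr_gt0 cost_gt1.
rewrite /a_ -/(cost x k) truncn_ge_nat; last by rewrite invr_ge0 ltW.
rewrite -[_^-1]mul1r ler_pdivlMr//.
by rewrite le_threshold// mulrBr mulr1 lerBlDr nat1r.
Qed.

Lemma a_mono x y k : 0 < x -> x <= y -> (0 < k)%N -> (a_ F x k <= a_ F y k)%N.
Proof.
move=> x0 xy k0; case E: (a_ F x k) => [//|n].
rewrite leq_a ?(lt_le_trans x0)//; apply: le_trans xy.
by rewrite -leq_a// E.
Qed.

Lemma gain_gt0 x k e : 0 < gain x k e.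
Proof. by rewrite divr_gt0 ?ltr0n// exprn_gt0// cost_gt0. Qed.

Lemma le_gainS x k e : 0 < x ->
  (gain x k e <= gain x k e.+1) = (threshold k e.+1 <= x).
Proof.
move=> x0; rewrite le_threshold// /gain exprSr invfM mulrA -(mulrAC _ _ (_ ^+ e)^-1).
by rewrite ler_pM2r ?invr_gt0 ?exprn_gt0 ?cost_gt0// ler_pdivlMr ?cost_gt0.
Qed.

Lemma lt_gainS x k e : 0 < x ->
  (gain x k e < gain x k e.+1) = (threshold k e.+1 < x).
Proof.
move=> x0; rewrite lt_threshold// /gain exprSr invfM mulrA -(mulrAC _ _ (_ ^+ e)^-1).
by rewrite ltr_pM2r ?invr_gt0 ?exprn_gt0 ?cost_gt0// ltr_pdivlMr ?cost_gt0.
Qed.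

(** Writing [e.+1 = a_ F x k] rather than using a predecessor excludes the second alternative when
    [a_ F x k] is [0]. *)
Definition optimal x k e : Prop :=
  e = a_ F x k \/ e.+1 = a_ F x k /\ threshold k (a_ F x k) = x.

Lemma le_gain_below x k e : 0 < x -> (0 < k)%N -> (e <= a_ F x k)%N ->
  gain x k e <= gain x k (a_ F x k).
Proof.
move=> x0 k0 /subnKC; move: (a_ F x k - e)%N => d; elim: d e => [|d IHd] e.
  by rewrite addn0 => ->.
rewrite addnS -addSn => ea; apply: le_trans (IHd _ ea).
by rewrite le_gainS// -leq_a// -ea leq_addr.
Qed.

Lemma lt_gain_above x k e : 0 < x -> (0 < k)%N -> (a_ F x k < e)%N ->
  gain x k e < gain x k (a_ F x k).
Proof.
move=> x0 k0; have step d : (a_ F x k <= d)%N -> gain x k d.+1 < gain x k d.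
  by move=> ad; rewrite ltNge le_gainS// -leq_a// -ltnNge ltnS.
elim: e => // e IHe; rewrite ltnS leq_eqVlt => /predU1P[<-|ae]; first exact: step.
by apply: lt_trans (IHe ae); apply/step/ltnW.
Qed.

Lemma gain_max x k e : 0 < x -> (0 < k)%N -> gain x k e <= gain x k (a_ F x k).
Proof.
move=> x0 k0; have [ea|ae] := leqP e (a_ F x k); first exact: le_gain_below.
exact/ltW/lt_gain_above.
Qed.

Lemma gain_optimal x k e : 0 < x -> (0 < k)%N ->
  gain x k e = gain x k (a_ F x k) <-> optimal x k e.
Proof.
move=> x0 k0; split=> [eq_gain|[->//|[ea ax]]]; last first.
  apply/eqP; rewrite -ea eq_le le_gainS// [X in _ && X]leNgt lt_gainS// ea ax.
  by rewrite ltxx lexx.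
have [ae|] := ltnP (a_ F x k) e.
  by have := lt_gain_above x0 k0 ae; rewrite eq_gain ltxx.
rewrite leq_eqVlt => /predU1P[|ea]; [by left|right].
move: (ea); rewrite leq_eqVlt => /predU1P[Ea|ea1].
  split=> //; apply/eqP; rewrite eq_le -leq_a ?leqnn//=; last by apply: leq_trans ea.
  by rewrite leNgt -Ea -lt_gainS// Ea eq_gain ltxx.
(* At least two steps below [a_ F x k], the threshold of [e.+1] is strictly smaller than that of
   [a_ F x k], hence than [x], so the gain still rises strictly. *)
have : gain x k e < gain x k e.+1.
  rewrite lt_gainS// (lt_le_trans (threshold_mono k0 _ ea1))// -leq_a//.
  by apply: leq_trans ea.
by move=> /lt_le_trans/(_ (le_gain_below x0 k0 ea)); rewrite eq_gain ltxx.
Qed.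

(** [threshold k 1] is [k] times [threshold 1 1], so it exceeds [x] for large [k]. *)
Lemma a_bounded x : 0 < x -> exists N, forall k, (N < k)%N -> a_ F x k = 0%N.
Proof.
move=> x0; exists (Num.truncn (x / threshold 1 1)) => k Nk.
have k0 : (0 < k)%N by apply: leq_trans Nk.
have t0 : 0 < threshold 1 1 by apply: threshold_gt0.
apply/eqP; rewrite -leqn0 leqNgt leq_a// -ltNge.
rewrite truncn_lt_nat in Nk; last by rewrite divr_ge0// ltW.
by move: Nk; rewrite ltr_pdivrMr// /threshold mul1r mulrA.
Qed.

(* Both fractions in [(1 + 1/m)^l = (1 + 1/n)^k] are reduced, so [m^l = n^k].  If
   [k < l] then [m <= n], whence [(1 + 1/n)^k <= (1 + 1/m)^k < (1 + 1/m)^l]. *)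
Lemma exp_succ_ratio_leq k l m n : (0 < m)%N -> (0 < n)%N ->
  (m.+1 ^ l * n ^ k = n.+1 ^ k * m ^ l)%N -> (l <= k)%N.
Proof.
move=> m0 n0 E; rewrite leqNgt; apply/negP => kl.
have cop i j : coprime (i.+1 ^ j) (i ^ j).
  by apply: coprimeXl; apply: coprimeXr; exact: coprimeSn.
have mn : (m ^ l = n ^ k)%N.
  apply/eqP; rewrite eqn_dvd; apply/andP; split.
    by rewrite -(@Gauss_dvdr _ (m.+1 ^ l)) ?E ?dvdn_mull// coprime_sym.
  by rewrite -(@Gauss_dvdr _ (n.+1 ^ k)) -?E ?dvdn_mull// coprime_sym.
have {}E : (m.+1 ^ l = n.+1 ^ k)%N.
  by apply/eqP; rewrite -(@eqn_pmul2r (n ^ k)) ?expn_gt0 ?n0// E mn.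
have k0 : (0 < k)%N.
  rewrite lt0n; apply/eqP => k0; have : (1 < m.+1 ^ l)%N.
    by rewrite -(expn0 m.+1) ltn_exp2l// (leq_ltn_trans _ kl).
  by rewrite E k0.
have lemn : (m <= n)%N by rewrite -(leq_exp2r _ _ k0) -mn leq_pexp2l// ltnW.
have : (n.+1 ^ k * m ^ k <= m.+1 ^ k * n ^ k)%N.
  by rewrite -!expnMn leq_exp2r// !mulSn mulnC leq_add2r.
rewrite -E -mn -(subnKC (ltnW kl)) !expnD mulnAC !mulnA leq_pmul2l; last first.
  by rewrite muln_gt0 !expn_gt0 m0.
by rewrite leq_exp2r ?subn_gt0// ltnn.
Qed.

(** Clearing denominators and exponentiating gives [(1 + 1/n)^k = (1 + 1/m)^l];
    [exp_succ_ratio_leq], used in both directions, yields [k = l], and monotonicity in the second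
    argument gives [m = n]. *)
Lemma threshold_inj k l m n : (0 < k)%N -> (0 < l)%N -> (0 < m)%N -> (0 < n)%N ->
  threshold k m = threshold l n -> k = l /\ m = n.
Proof.
move=> k0 l0 m0 n0 E; have lnq := ln_q_gt0.
have {}kl : k = l.
  have frac i : (0 < i)%N -> 1 + i%:R^-1 = i.+1%:R / i%:R :> R.
    by move=> i0; rewrite -natr1 mulrDl divff ?div1r// pnatr_eq0 -lt0n.
  have {E} : ln ((1 + n%:R^-1 : R) ^+ k) = ln ((1 + m%:R^-1) ^+ l).
    rewrite !lnXn ?addr_gt0 ?invr_gt0 ?ltr0n// -[LHS]mulr_natl -[RHS]mulr_natl.
    apply: (mulIf (lt0r_neq0 lnq)).
    move/eqP: E; rewrite /threshold eqr_div ?(lt0r_neq0 (ln1DV_gt0 _))// => /eqP.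
    by rewrite -!mulrA ![ln q * _]mulrC !mulrA.
  move=> /(ln_inj _ _); rewrite !posrE !exprn_gt0 ?addr_gt0 ?invr_gt0 ?ltr0n//.
  move=> /(_ erefl erefl); rewrite !frac// !expr_div_n => /eqP.
  rewrite eqr_div ?expf_neq0 ?pnatr_eq0 -?lt0n// -!natrX -!natrM eqr_nat => /eqP E.
  apply/eqP; rewrite eqn_leq (@exp_succ_ratio_leq l k n m)//.
  by rewrite (@exp_succ_ratio_leq k l m n).
split=> //; subst l; have [mn|nm|//] := ltngtP m n.
  by have := threshold_mono k0 m0 mn; rewrite E ltxx.
by have := threshold_mono k0 n0 nm; rewrite E ltxx.
Qed.

End LocalFactor.

(** * Semi-superior highly composite polynomials *)

Section SSHC.
Variables (R : realType) (F : finFieldType).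
Implicit Types (x y : R) (f g h p : {poly F}) (e : {poly F} -> nat) (N M : nat).
Local Notation q := (#|F|%:R : R).

(** A single strict inequality among positive factors would make the product of [u] strictly
    smaller. This passes from maximality of a product of gains to maximality of each gain. *)
Lemma prod_le_eq (I : eqType) (s : seq I) (u v : I -> R) :
  {in s, forall i, 0 < u i <= v i} -> \prod_(i <- s) v i <= \prod_(i <- s) u i ->
  {in s, u =1 v}.
Proof.
move=> uv; have pos w (t : seq I) : {in t, forall i, 0 < w i} ->
    0 < \prod_(i <- t) w i :> R.
  by move=> w0; rewrite big_seq; apply: prodr_gt0 => i /w0.
have mono t : {subset t <= s} -> \prod_(i <- t) u i <= \prod_(i <- t) v i.
  move=> ts; rewrite big_seq [leRHS]big_seq.
  by apply: ler_prod => i /ts/uv/andP[/ltW -> ->].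
move=> le_prod i si; have /andP[ui uvi] := uv _ si.
apply/eqP; rewrite eq_le uvi leNgt; apply/negP => lt_uv.
have rem_s : {subset rem i s <= s} by move=> j; exact: mem_rem.
move: le_prod; rewrite (big_rem i si)/= [leRHS](big_rem i si)/= leNgt => /negP; apply.
rewrite (@le_lt_trans _ _ (u i * \prod_(y <- rem i s) v y))//.
  by rewrite ler_pM2l// mono.
by rewrite ltr_pM2r// pos// => j /rem_s/uv/andP[/lt_le_trans]; apply.
Qed.

Lemma q_powR_deg x N e : q `^ ((deg (pprod N e))%:R / x) =
  \prod_(p <- irr_seq F N) cost F x (deg p) ^+ e p.
Proof.
rewrite deg_prod_exp; last exact: irr_seq_irr.
rewrite natr_sum mulr_suml; elim/big_rec2 : _ => [|p u v _ uv]; first by rewrite powRr0.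
rewrite powRD ?pnatr_eq0 -?lt0n ?(ltnW (card_finNzRing_gt1 F)) ?implybT// uv.
by rewrite natrM -mulrA [_%:R * _]mulrC powRrM powR_mulrn// powR_ge0.
Qed.

Lemma tau_ratio_pprod x N e : tau_ratio x (pprod N e) =
  \prod_(p <- irr_seq F N) gain F x (deg p) (e p).
Proof.
rewrite /tau_ratio q_powR_deg tau_prod_exp ?uniq_irr_seq//; last exact: irr_seq_irr.
rewrite -prodfV natr_prod -big_split/=; exact: eq_bigr.
Qed.

Lemma hhat_pprod x N : (forall k, (N < k)%N -> a_ F x k = 0%N) ->
  hhat F x = pprod N (fun p => a_ F x (deg p)).
Proof.
move=> aN; rewrite /hhat -(fsbig_widen [set` index_iota 1 N.+1]).
- rewrite -[LHS]fsbig_seq ?iota_uniq// {aN}.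
  elim: N => [|N IHN]; first by rewrite big_nil /pprod big_nil.
  rewrite big_nat_recr//= IHN /pprod/= big_cat/=; congr (_ * _).
  rewrite fsbig_finite; last exact: finite_Irr.
  apply: eq_big_seq => p; rewrite in_fset_set ?inE; last exact: finite_Irr.
  by move=> [[_ ->]].
- by move=> k /=; rewrite mem_index_iota => /andP[].
- move=> k [/= k1 /negP]; rewrite mem_index_iota k1/= ltnS -ltnNge => Nk.
  by apply: fsbig1 => p _; rewrite aN.
Qed.

Lemma pprod_truncate N M e : (N <= M)%N ->
  pprod M (fun p => if (deg p <= N)%N then e p else 0%N) = pprod N e.
Proof.
move=> NM; rewrite (pprod_widen NM); last first.
  by move=> p _ /andP[Np _]; rewrite leqNgt Np.
by apply: eq_pprod => p /mem_irr_seq[_ ->].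
Qed.

Lemma irr_seq_deg_gt0 N p : p \in irr_seq F N -> (0 < deg p)%N.
Proof. by move=> /mem_irr_seq[[_ /deg_irreducible_gt0]]. Qed.

(** Ratios are compared factor by factor over irreducibles of degree at most [M], where [M] is at
    least [N] and the degree of the polynomial at hand. Forward, [h] is compared with [hhat];
    backward, an arbitrary [f] is compared with [pprod N e]. *)
Lemma SSHC_pprod x N h : 0 < x -> (forall k, (N < k)%N -> a_ F x k = 0%N) ->
  SSHC_at x h <-> exists2 e, h = pprod N e &
    {in irr_seq F N, forall p, optimal F x (deg p) (e p)}.
Proof.
move=> x0 aN.
have aM M : (N <= M)%N -> forall k, (M < k)%N -> a_ F x k = 0%N.
  by move=> NM k Mk; apply/aN/(leq_ltn_trans NM).
split=> [[hm hmax]|[e -> eopt]].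
  have NM : (N <= maxn N (deg h))%N by rewrite leq_maxl.
  have [e De] := pprod_exists hm (leq_maxr N (deg h)).
  set M := maxn N (deg h) in NM De.
  have eopt : {in irr_seq F M, forall p, optimal F x (deg p) (e p)}.
    move=> p pM; apply/gain_optimal => //; first exact: irr_seq_deg_gt0 pM.
    pose u (e : {poly F} -> nat) p := gain F x (deg p) (e p).
    apply: (@prod_le_eq _ _ (u e) (u (fun p => a_ F x (deg p))) _ _ p pM) => [r rM|].
      by rewrite gain_gt0 gain_max// (irr_seq_deg_gt0 rM).
    rewrite -!tau_ratio_pprod -De -(hhat_pprod (aM _ NM)); apply: hmax.
    by rewrite (hhat_pprod (aM _ NM)) /Monic/= monic_pprod.
  (* Beyond [N] the optimum [a_ F x (deg p)] is [0], which leaves [0] as the only optimal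
     exponent. *)
  have eN p : monic_irreducible p -> (N < deg p <= M)%N -> e p = 0%N.
    move=> pirr /andP[Np pM]; have pM' : p \in irr_seq F M by apply/mem_irr_seq.
    by have [|[]] := eopt p pM'; rewrite aN.
  exists e; first by rewrite De (pprod_widen NM).
  move=> p /mem_irr_seq[pirr pN]; apply/eopt/mem_irr_seq.
  by split; rewrite ?(leq_trans pN).
split=> [|f fm]; first exact: monic_pprod.
have NM : (N <= maxn N (deg f))%N by rewrite leq_maxl.
have [e' De'] := pprod_exists fm (leq_maxr N (deg f)).
set M := maxn N (deg f) in NM De'.
rewrite De' -(pprod_truncate e NM) !tau_ratio_pprod.
rewrite big_seq [leRHS]big_seq; apply: ler_prod => p pM.
have p0 := irr_seq_deg_gt0 pM; rewrite ltW ?gain_gt0//=.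
rewrite (_ : gain F x (deg p) (if _ then _ else _) = gain F x (deg p) (a_ F x (deg p))).
  exact: gain_max.
case: ifPn => [pN|]; last by rewrite -ltnNge => Np; rewrite aN.
apply/gain_optimal => //; apply/eopt/mem_irr_seq; split=> //.
by have /mem_irr_seq[] := pM.
Qed.

Lemma SSHC_hhat x : 0 < x -> SSHC_at x (hhat F x).
Proof.
move=> x0; have [N aN] := a_bounded F x0; apply/(SSHC_pprod _ x0 aN).
by exists (fun p => a_ F x (deg p)); [exact: hhat_pprod|left].
Qed.

Lemma SSHC_dvdp_hhat x h : 0 < x -> SSHC_at x h -> h %| hhat F x.
Proof.
move=> x0; have [N aN] := a_bounded F x0 => /(SSHC_pprod _ x0 aN)[e -> eopt].
rewrite (hhat_pprod aN); apply: dvdp_pprod => p /eopt[->//|[<- _]]; exact: leqnSn.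
Qed.

(** The strict inequality for larger degrees selects the semi-superior polynomials of largest
    degree. All semi-superior ones divide [hhat F x], so it is the only one of that degree. *)
Lemma SHC_atP x h : 0 < x -> SHC_at x h <-> h = hhat F x.
Proof.
move=> x0; have hhatSSHC := SSHC_hhat x0; split=> [[hm hmax]|->].
  have hSSHC : SSHC_at x h.
    split=> // f fm; have [fh hf] := hmax f fm.
    by have [/fh|/hf/ltW] := leqP (deg f) (deg h).
  apply: monic_dvdp_deg_eq => //; [by case: hhatSSHC|exact: SSHC_dvdp_hhat|].
  rewrite leqNgt; apply/negP => /(hmax _ hhatSSHC.1).2.
  by rewrite ltNge hhatSSHC.2.
split; first by case: hhatSSHC.
move=> f fm; split=> [_|hf]; first exact: hhatSSHC.2.
rewrite ltNge; apply/negP => le_ratio.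
have /(SSHC_dvdp_hhat x0) : SSHC_at x f.
  by split=> // g gm; apply: le_trans le_ratio; apply: hhatSSHC.2.
have h0 := monic_neq0 hhatSSHC.1.
move=> /(dvdp_leq h0); apply/negP; rewrite -ltnNge; move: hf; rewrite /deg.
by case: (size f) (size (hhat F x)) => // a []//; rewrite -size_poly_gt0 in h0.
Qed.

Lemma hhat_mono x y : 0 < x -> x <= y -> hhat F x %| hhat F y.
Proof.
move=> x0 xy; have y0 := lt_le_trans x0 xy.
have [N aN] := a_bounded F y0.
rewrite (hhat_pprod aN) (@hhat_pprod x N) => [|k Nk].
  by apply: dvdp_pprod => p /irr_seq_deg_gt0 p0; exact: a_mono.
apply/eqP; rewrite -leqn0 -(aN _ Nk) a_mono//; exact: leq_ltn_trans Nk.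
Qed.

End SSHC.

Lemma ppi_gt0 (F : finFieldType) k : (0 < k)%N -> (0 < ppi F k)%N.
Proof.
move=> k0; have [p [pm pirr szp]] := exists_monic_irreducible F k0.
rewrite /ppi cardfs_gt0; apply/fset0Pn; exists p.
rewrite in_fset_set ?inE; last exact: finite_Irr.
by split=> //; split=> //; rewrite /deg szp.
Qed.

(** * Semi-superior highly composite polynomials at a threshold *)

Section Threshold.
Variables (R : realType) (F : finFieldType) (x : R) (s r : nat).
Hypotheses (x_gt0 : 0 < x) (s_gt0 : (0 < s)%N) (r_gt0 : (0 < r)%N).
Hypothesis xE : x = threshold R F s r.
Implicit Types (A B : {fset {poly F}}) (h p : {poly F}).

Lemma a_threshold : a_ F x s = r.
Proof.
apply/eqP; rewrite eqn_leq [X in _ && X]leq_a// -xE lexx andbT leqNgt leq_a//.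
by rewrite -ltNge {1}xE threshold_mono.
Qed.

(** By [threshold_inj], [x] is a threshold for the degree [s] alone, so no other degree has a second
    optimal exponent. *)
Lemma optimal_threshold k e : (0 < k)%N ->
  optimal F x k e <-> e = a_ F x k \/ (k = s /\ e.+1 = a_ F x k).
Proof.
move=> k0; split=> [[|[ea ax]]|[|[-> ea]]]; [by left| |by left|].
  right; split=> //; have a0 : (0 < a_ F x k)%N by rewrite -ea.
  by have [] := threshold_inj k0 s_gt0 a0 r_gt0 (etrans ax xE).
by right; split=> //; rewrite a_threshold.
Qed.

Section Truncation.
Variables (N : nat) (aN : forall k, (N < k)%N -> a_ F x k = 0%N).

Lemma sub_Irr_irr_seq A : [set` A] `<=` Irr F s -> {subset A <= irr_seq F N}.
Proof.
move=> As p /As[[pm ps] pirr]; apply/mem_irr_seq; split=> //; rewrite ps leqNgt.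
by apply/negP => /aN; rewrite a_threshold => r0; move: r_gt0; rewrite r0.
Qed.

Lemma hhat_factor A : [set` A] `<=` Irr F s ->
  hhat F x = \prod_(p <- A) p * pprod N (fun p => a_ F x (deg p) - (p \in A))%N.
Proof.
move=> As; rewrite (hhat_pprod aN) -(@prod_indicator _ N) ?fset_uniq//; last first.
  exact: sub_Irr_irr_seq.
rewrite -pprodD; apply: eq_pprod => p _; rewrite subnKC//.
have [/As[[_ ->] _]|//] := boolP (p \in A); by rewrite a_threshold.
Qed.

Lemma monic_prod_Irr A : [set` A] `<=` Irr F s -> \prod_(p <- A) p \is monic.
Proof.
by move=> As; rewrite big_seq; apply: monic_prod => p /As[[]].
Qed.

Lemma hhat_divE A : [set` A] `<=` Irr F s ->
  hhat F x %/ \prod_(p <- A) p = pprod N (fun p => a_ F x (deg p) - (p \in A))%N.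
Proof.
by move=> As; rewrite (hhat_factor As) mulKp// monic_neq0// monic_prod_Irr.
Qed.

Lemma SSHC_hhat_div h : SSHC_at x h <->
  exists2 A : {fset {poly F}}, [set` A] `<=` Irr F s & h = hhat F x %/ \prod_(p <- A) p.
Proof.
rewrite (SSHC_pprod _ x_gt0 aN); split=> [[e -> eopt]|[A As ->]]; last first.
  exists (fun p => a_ F x (deg p) - (p \in A))%N; first exact: hhat_divE.
  move=> p pN; apply/optimal_threshold; first exact: irr_seq_deg_gt0 pN.
  have [/As[[_ ->] _]|_] := boolP (p \in A); last by left; rewrite subn0.
  by right; rewrite a_threshold subn1 prednK.
(* [A] collects the irreducibles at which the lower of the two optimal exponents is taken; these
   have degree [s]. *)
pose A := [fset p in irr_seq F N | e p != a_ F x (deg p)]%fset.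
have As : [set` A] `<=` Irr F s.
  move=> p; rewrite /A /= !inE /= => /andP[pN ep].
  have [/(elimN eqP ep)//|[ps _]] :=
    (optimal_threshold (e p) (irr_seq_deg_gt0 pN)).1 (eopt _ pN).
  by have /mem_irr_seq[[pm pirr] _] := pN.
exists A => //; rewrite hhat_divE//; apply: eq_pprod => p pN.
have -> : p \in A = (e p != a_ F x (deg p)) by rewrite !inE/= pN.
have [->|[_ <-]] := (optimal_threshold (e p) (irr_seq_deg_gt0 pN)).1 (eopt _ pN).
  by rewrite eqxx subn0.
by rewrite neq_ltn ltnSn subn1.
Qed.

Lemma deg_hhat_div A : [set` A] `<=` Irr F s ->
  (deg (hhat F x %/ \prod_(p <- A) p)%R + #|` A| * s)%N = deg (hhat F x).
Proof.
move=> As; rewrite (hhat_divE As) {1}(hhat_factor As) degM ?monic_neq0 ?monic_pprod//;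
  last exact: monic_prod_Irr.
rewrite addnC; congr (_ + _)%N.
have := @deg_prod_exp F A (fun=> 1%N); under eq_bigr do rewrite expr1.
move=> ->; last by move=> p /As[[]].
rewrite (eq_big_seq (fun=> s)) ?big_const_seq ?count_predT ?iter_addn_0 1?mulnC//.
by move=> p /As[[_ ->] _]; rewrite mul1n.
Qed.

End Truncation.

(** Equal quotients of [hhat F x] come from equal divisors, and a product of distinct irreducibles
    determines its factors through divisibility. Counting subsets of [Irr F s] then counts the
    polynomials. *)
Lemma prod_Irr_inj A B : [set` A] `<=` Irr F s -> [set` B] `<=` Irr F s ->
  hhat F x %/ \prod_(p <- A) p = hhat F x %/ \prod_(p <- B) p -> A = B.
Proof.
have [N aN] := a_bounded F x_gt0; move=> As Bs.
rewrite (hhat_divE aN As) (hhat_divE aN Bs) => AB.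
have prodAB : \prod_(p <- A) p = \prod_(p <- B) p.
  have := hhat_factor aN As; rewrite {1}(hhat_factor aN Bs) AB.
  by move=> /mulIf ->//; rewrite monic_neq0// monic_pprod.
have irr (C : {fset {poly F}}) : [set` C] `<=` Irr F s ->
    {in C, forall p, monic_irreducible p}.
  by move=> Cs p /Cs[[]].
apply/fsetP => p; apply/idP/idP => [pA|pB].
  have /As[[pm _] pirr] := pA.
  by rewrite -dvdp_prod_seq -?prodAB ?dvdp_prod_seq//; exact: irr.
have /Bs[[pm _] pirr] := pB.
by rewrite -dvdp_prod_seq ?prodAB ?dvdp_prod_seq//; exact: irr.
Qed.

Lemma card_SSHC : ([set h : {poly F} | SSHC_at x h] #= `I_(2 ^ ppi F s))%card.
Proof.
have [N aN] := a_bounded F x_gt0.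
pose P := fpowerset (fset_set (Irr F s)).
have subP A : A \in P <-> [set` A] `<=` Irr F s.
  rewrite fpowersetE; split=> [/fsubsetP AI p /AI|AI].
    by rewrite in_fset_set ?inE//; exact: finite_Irr.
  by apply/fsubsetP => p /AI; rewrite in_fset_set ?inE//; exact: finite_Irr.
have -> : [set h | SSHC_at x h] =
    (fun A => hhat F x %/ \prod_(p <- A) p) @` [set` P].
  apply/seteqP; split=> [h /(SSHC_hhat_div aN)[A As ->]|h [A /subP As <-]].
    by exists A => //; exact/subP.
  by apply/(SSHC_hhat_div aN); exists A.
apply: card_eq_trans (inj_card_eq _) _.
  by move=> A B; rewrite !inE => /subP As /subP Bs; exact: prod_Irr_inj.
by apply/card_eq_fsetP; rewrite card_fpowerset.
Qed.

(** * The two consecutive superior highly composite polynomials at a threshold *)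

Definition hlow : {poly F} := hhat F x %/ \prod_(p <- fset_set (Irr F s)) p.

Lemma set_Irr : [set` fset_set (Irr F s)] `<=` Irr F s.
Proof. by rewrite fset_setK//; exact: finite_Irr. Qed.

Lemma hlow_pprod N : (forall k, (N < k)%N -> a_ F x k = 0%N) ->
  hlow = pprod N (fun p => a_ F x (deg p) - (deg p == s))%N.
Proof.
move=> aN; rewrite /hlow (hhat_divE aN set_Irr); apply: eq_pprod => p pN.
have /mem_irr_seq[[pm pirr] _] := pN.
congr (_ - nat_of_bool _)%N; rewrite in_fset_set; last exact: finite_Irr.
by apply/idP/eqP => [|ps]; rewrite inE; [case=> -[]|split].
Qed.

(** Exponents only decrease when passing from [x] to [y], and in degree [s] they drop by at least
    one, since [y] lies below [threshold s r]. *)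
Lemma hhat_lt_dvdp_hlow y : 0 < y -> y < x -> hhat F y %| hlow.
Proof.
move=> y0 yx; have [N aN] := a_bounded F x_gt0.
have aNy k : (N < k)%N -> a_ F y k = 0%N.
  move=> Nk; apply/eqP; rewrite -leqn0 -(aN _ Nk) a_mono ?ltW//.
  exact: leq_ltn_trans Nk.
rewrite (hlow_pprod aN) (hhat_pprod aNy); apply: dvdp_pprod => p /irr_seq_deg_gt0 p0.
have le_a := a_mono F y0 (ltW yx) p0.
have [ps|_] := eqVneq (deg p) s; last by rewrite subn0.
rewrite ps a_threshold subn1 -ltnS prednK// ltnNge leq_a// -xE.
by rewrite -ltNge.
Qed.

(** Each positive exponent [b k] of [hlow] has its threshold strictly below [x]. Only finitely many
    degrees matter, so some [y < x] exceeds all these thresholds. *)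
Lemma hlow_dvdp_hhat_lt : exists y, [/\ 0 < y, y < x & hlow %| hhat F y].
Proof.
have [N aN] := a_bounded F x_gt0; rewrite (hlow_pprod aN).
pose b k := (a_ F x k - (k == s))%N.
have b_lt k : (0 < k)%N -> (0 < b k)%N -> threshold R F k (b k) < x.
  move=> k0; rewrite /b; have [->|ks] := eqVneq k s.
    rewrite a_threshold subn1 => r1; rewrite [ltRHS]xE threshold_mono//.
    by rewrite prednK.
  (* For [k != s] the threshold is at most [x], and equality would force [k = s]. *)
  rewrite subn0 => a0; rewrite lt_neqAle -leq_a// leqnn andbT.
  apply: contraNneq ks => kx.
  by have [->] := threshold_inj k0 s_gt0 a0 r_gt0 (etrans kx xE).
have [y0 [y0_ge0 y0x Hy0]] : exists y0, [/\ 0 <= y0, y0 < x & forall y, y0 < y ->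
    forall k, (0 < k <= N)%N -> (b k <= a_ F y k)%N].
  elim: {aN} N => [|n [y0 [y0_ge0 y0x IHn]]].
    by exists 0; split=> // y _ k; case: k.
  have [bn0|bn0] := posnP (b n.+1).
    exists y0; split=> // y y0y k /andP[k0]; rewrite leq_eqVlt => /predU1P[->|kn].
      by rewrite bn0.
    by apply: IHn => //; rewrite k0.
  exists (Num.max y0 (threshold R F n.+1 (b n.+1))).
  rewrite le_max y0_ge0 gt_max y0x b_lt//; split=> // y.
  rewrite gt_max => /andP[y0y ty] k /andP[k0].
  rewrite leq_eqVlt => /predU1P[->|kn]; last by apply: IHn => //; rewrite k0.
  by rewrite leq_a ?(ltW ty)// (le_lt_trans y0_ge0).
have := midf_lt y0x; set y := _ / 2 => -[y0y yx].
have y_gt0 : 0 < y by apply: le_lt_trans y0y.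
exists y; split=> //.
rewrite (@hhat_pprod _ _ y N) => [|k Nk].
  apply: dvdp_pprod => p pN; apply: Hy0 => //; rewrite (irr_seq_deg_gt0 pN).
  by have /mem_irr_seq[] := pN.
apply/eqP; rewrite -leqn0 -(aN _ Nk) a_mono ?ltW//; exact: leq_ltn_trans Nk.
Qed.

(** [hlow] equals [hhat F y] for some [y < x], by divisibility both ways. Any other [hhat F y]
    divides [hlow] if [y < x] and is a multiple of [hhat F x] if [x <= y], so the degree bounds
    force equality. *)
Lemma consecutive_hlow_hhat : consecutive_SHC R hlow (hhat F x).
Proof.
have hm : hhat F x \is monic by case: (SSHC_hhat F x_gt0).
have [N aN] := a_bounded F x_gt0.
have lm : hlow \is monic by rewrite (hlow_pprod aN) monic_pprod.
split.
- have [y [y0 yx hy]] := hlow_dvdp_hhat_lt; exists y => //; apply/SHC_atP => //.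
  have ym : hhat F y \is monic by case: (SSHC_hhat F y0).
  apply/eqP; rewrite -eqp_monic// /eqp hy; exact: hhat_lt_dvdp_hlow.
- by exists x => //; apply/SHC_atP.
- have := deg_hhat_div aN set_Irr; rewrite -/hlow => <-.
  by rewrite -[ltnLHS]addn0 ltn_add2l muln_gt0 s_gt0 ppi_gt0.
- move=> g [y y0 /(SHC_atP _ y0) ->] /andP[lo hi].
  have ym : hhat F y \is monic by case: (SSHC_hhat F y0).
  have [xy|yx] := leP x y.
    right; apply/esym/monic_dvdp_deg_eq => //; exact: hhat_mono.
  left; apply: monic_dvdp_deg_eq => //; exact: hhat_lt_dvdp_hlow.
Qed.

Lemma deg_hhat_quotient v h : hhat_quotient x s v h ->
  (deg h + v * s)%N = deg (hhat F x).
Proof.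
have [N aN] := a_bounded F x_gt0.
by move=> [A [As <- ->]]; rewrite (deg_hhat_div aN).
Qed.

Lemma card_sub_Irr A : [set` A] `<=` Irr F s -> (#|` A| <= ppi F s)%N.
Proof.
move=> As; apply: fsubset_leq_card; apply/fsubsetP => p /As.
by rewrite in_fset_set ?inE//; exact: finite_Irr.
Qed.

Lemma unique_hlow : unique (hhat_quotient x s (ppi F s)) hlow.
Proof.
split; first by exists (fset_set (Irr F s)); split=> //; exact: set_Irr.
move=> h [A [As cA ->]]; rewrite /hlow; suff -> : A = fset_set (Irr F s) by [].
apply/eqP; rewrite eqEfcard cA leqnn andbT; apply/fsubsetP => p /As.
by rewrite in_fset_set ?inE//; exact: finite_Irr.
Qed.

Lemma unique_hhat : unique (hhat_quotient x s 0) (hhat F x).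
Proof.
split; first by exists fset0; rewrite big_seq_fset0 divp1 cardfs0.
by move=> h [A [_ /cardfs0_eq -> ->]]; rewrite big_seq_fset0 divp1.
Qed.

End Threshold.

Theorem theorem1p2 (R : realType) (F : finFieldType) (x : R) (x_gt0 : 0 < x) :
  [/\ (~ Sset F x -> forall h : {poly F}, SSHC_at x h <-> h = hhat F x),
      (forall s r : nat, (1 <= s)%N -> (1 <= r)%N ->
        x = s%:R * ln (#|F|%:R : R) / ln (1 + r%:R^-1) ->
        [/\ (forall A : {fset {poly F}}, [set` A] `<=` Irr F s ->
              \prod_(p <- A) p %| hhat F x),
            (forall h : {poly F}, SSHC_at x h <->
              exists2 v : nat, (v <= ppi F s)%N & hhat_quotient x s v h),
            ([set h : {poly F} | SSHC_at x h] #= `I_(2 ^ ppi F s))%card,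
            (forall (v : nat) (h : {poly F}), (v <= ppi F s)%N ->
              hhat_quotient x s v h -> (deg h + v * s)%N = deg (hhat F x)) &
            exists h1 h2 : {poly F},
              [/\ unique (hhat_quotient x s (ppi F s)) h1,
                  unique (hhat_quotient x s 0) h2 &
                  consecutive_SHC R h1 h2]]) &
      (forall h g : {poly F}, SSHC_at x h -> MonicDeg (deg h) g ->
        highly_composite g -> SSHC_at x g)].
Proof.
have [N aN] := a_bounded F x_gt0; split.
- move=> xS h; rewrite (SSHC_pprod _ x_gt0 aN) (hhat_pprod aN).
  split=> [[e -> eopt]|->]; last by exists (fun p => a_ F x (deg p)) => // p _; left.
  (* A second optimal exponent at [p] would put [x] in [Sset], with [s = deg p] and
     [r = a_ F x (deg p)]. *)
  apply: eq_pprod => p pN; have [//|[ea ax]] := eopt _ pN; case: xS.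
  exists (deg p), (a_ F x (deg p)); split; [exact: irr_seq_deg_gt0 pN| |exact/esym].
  by rewrite -ea.
- move=> s r s1 r1 xE; split.
  + by move=> A As; rewrite (hhat_factor x_gt0 s1 r1 xE aN As) dvdp_mulr.
  + move=> h; rewrite (SSHC_hhat_div x_gt0 s1 r1 xE aN); split.
      move=> [A As ->]; exists #|` A|; last by exists A.
      exact: card_sub_Irr.
    by move=> [v _ [A [As _ ->]]]; exists A.
  + exact: card_SSHC xE.
  + move=> v h _; exact: deg_hhat_quotient xE v h.
  + exists (hlow F x s), (hhat F x); split; [exact: unique_hlow|exact: unique_hhat|].
    exact: consecutive_hlow_hhat xE.
(* Equal degrees give equal denominators, and [tau h <= tau g] since [g] is highly composite. *)
- move=> h g [hm hmax] [gm gh] [_ gmax]; split=> // f fm.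
  apply: le_trans (hmax _ fm) _; rewrite /tau_ratio gh ler_wpM2r ?invr_ge0 ?powR_ge0//.
  by rewrite ler_nat gmax// gh.
Qed.
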